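(* For each $cd$-word $w$ with $k$ letters $d$ and weight $n$, there exists an even interval system $\mathcal I_w$ on $[1,n]$ for which the $cd$-index of the doubled limit poset $DP(n,\mathcal I_w)$ is $2^k w$.
   Context: A graded poset is a finite partially ordered set $P$ with a unique minimum $\hat 0$, a unique maximum $\hat 1$, and a rank function $\rho:P\to\mathbf{N}$ with $\rho(\hat 0)=0$ and $\rho(y)-\rho(x)=1$ whenever $y$ covers $x$; its rank is $\rho(\hat 1)$. For $P$ of rank $n+1$ and $S\subseteq[1,n]=\{1,\dots,n\}$, $f_S(P)$ is the number of chains $x_1<\cdots<x_{|S|}$ in $P$ with $\{\rho(x_1),\dots,\rho(x_{|S|})\}=S$. For an interval $I\subseteq[1,n]$ and a positive integer $N$, $D_I^N(P)$ is obtained from $P$ by replacing every $x\in P$ with $\rho(x)\in I$ by $N$ elements $x_1,\dots,x_N$, with: (i) if $\rho(x)\in I$, $\rho(y)\notin I$, then $x_i<y$ iff $x<y$ in $P$, and $y<x_i$ iff $y<x$ in $P$; (ii) if $\rho(x),\rho(y)\in I$, then $x_i<y_j$ iff $i=j$ and $x<y$ in $P$; other relations unchanged. An interval system on $[1,n]$ is a set of (nonempty) subintervals of $[1,n]$, none contained in another; it is even if $|I\cap J|$ is even for all $I,J\in\mathcal I$ (including $I=J$). $P(n,\mathcal I,N)$ is obtained from a chain of rank $n+1$ by applying $D_I^N$ for all $I\in\mathcal I$ (order irrelevant). The flag vector of the doubled limit poset $DP(n,\mathcal I)$ is defined by $$f_S(DP(n,\mathcal I))=2^{|S|}\lim_{N\to\infty}\frac{f_S(P(n,\mathcal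 I,N))}{N^{|\mathcal I|}},\qquad S\subseteq[1,n].$$ For any vector $(f_S)_{S\subseteq[1,n]}$ put $h_S=\sum_{T\subseteq S}(-1)^{|S\setminus T|}f_T$; the $ab$-index is the polynomial $\Psi(a,b)=\sum_{S\subseteq[1,n]}h_S u_S$ in noncommuting variables $a,b$, where $u_S=u_1\cdots u_n$ with $u_i=b$ if $i\in S$ and $u_i=a$ if $i\notin S$. If $\Psi$ can be written as a polynomial in the noncommuting variables $c=a+b$ and $d=ab+ba$, that polynomial is the $cd$-index (for $DP(n,\mathcal I)$ it is computed from the vector $f_S(DP(n,\mathcal I))$). A $cd$-word is a word in $c$ and $d$; its weight is (number of $c$'s) $+\,2\cdot$(number of $d$'s). *)

(* Defs.v *)
From HB Require Import structures.
From mathcomp Require Import all_boot all_order all_algebra finmap.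
From mathcomp Require Import classical_sets reals topology normedtype sequences.
(* The notations of monalg clash with those of mathcomp-analysis. *)
From mathcomp Require Import -(notations) monalg.

Set Implicit Arguments.
Unset Strict Implicit.
Unset Printing Implicit Defensive.

Import Order.TTheory GRing.Theory Num.Theory.
Import numFieldNormedType.Exports.

Local Open Scope fset_scope.
Local Open Scope ring_scope.

(** * Graded posets and flag numbers *)

(* Subsets of [1,n] are sets of ordinals, i : 'I_n standing for the rank i+1;
   [ranks S] is the actual set of ranks. *)
Definition ranks (n : nat) (S : {set 'I_n}) : {fset nat} :=
  [fset (val i).+1 | i in S].

(* A finite set with a strict relation and a rank function.  The axioms of a
   graded poset are kept apart, in [graded], so that D below is a total
   operation; [D_graded] and [Pnin_graded] show that they always hold here. *)
Record ranked := Ranked {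
  elt : finType;
  rlt : rel elt;
  rho : elt -> nat }.

Section Graded.
Variable P : ranked.
Implicit Types x y z : elt P.

Definition covers y x : Prop :=
  rlt x y /\ ~ (exists z, rlt x z /\ rlt z y).

Definition graded (r : nat) : Prop :=
  [/\ irreflexive (@rlt P),
      transitive (@rlt P),
      exists2 bot, forall x, x != bot -> rlt bot x & rho bot = 0%N,
      exists2 top, forall x, x != top -> rlt x top & rho top = r
    & forall x y, covers y x -> rho y = (rho x).+1].

Definition flagf (n : nat) (S : {set 'I_n}) : nat :=
  #|[set t : #|S|.-tuple (elt P) |
      sorted (@rlt P) t && ([fset rho x | x in tval t] == ranks S)]|.

Lemma graded_rho_lt r x y : graded r -> rlt x y -> (rho x < rho y)%N.
Proof.
case=> irr tr _ _ cov.
have [k] := ubnP #|[set z | rlt x z && rlt z y]|.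
elim: k x y => // k IH x y; rewrite ltnS => le_k xy.
case: (pickP (fun z => rlt x z && rlt z y)) => [z /andP[xz zy]|none]; last first.
  by rewrite (cov x y) //; split=> // -[z []]; move: (none z) => + xz zy; rewrite xz zy.
have z_in : z \in [set z | rlt x z && rlt z y] by rewrite inE xz zy.
apply: (@ltn_trans (rho z)).
- apply: IH xz; apply: leq_trans le_k; apply: proper_card; apply/properP.
  split; last by exists z => //; rewrite inE irr andbF.
  by apply/fintype.subsetP=> w; rewrite !inE => /andP[-> /tr]; apply.
- apply: IH zy; apply: leq_trans le_k; apply: proper_card; apply/properP.
  split; last by exists z => //; rewrite inE irr.
  by apply/fintype.subsetP=> w; rewrite !inE => /andP[zw ->]; rewrite (tr _ _ _ xz zw).
Qed.

End Graded.

Definition chain_poset (r : nat) : ranked :=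
  @Ranked 'I_r.+1 (fun i j => (i < j)%N) (@nat_of_ord r.+1).

Section Replicate.
Variables (n : nat) (I : {set 'I_n}) (N : nat) (P : ranked).

Definition in_ranks (x : elt P) : bool := rho x \in ranks I.

(* [inl x] is an element kept by D_I^N, [inr (x, i)] is the copy x_i. *)
Definition Delt : finType :=
  ({x : elt P | ~~ in_ranks x} + {x : elt P | in_ranks x} * 'I_N)%type.

Definition Dlt (u v : Delt) : bool :=
  match u, v with
  | inl x, inl y => rlt (val x) (val y)
  | inl x, inr (y, _) => rlt (val x) (val y)
  | inr (x, _), inl y => rlt (val x) (val y)
  | inr (x, i), inr (y, j) => (i == j) && rlt (val x) (val y)
  end.

Definition Dval (u : Delt) : elt P :=
  match u with inl x => val x | inr (x, _) => val x end.

Definition D : ranked := Ranked Dlt (fun u => rho (Dval u)).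

End Replicate.

(** * Interval systems *)

Definition subinterval (n : nat) (I : {set 'I_n}) : Prop :=
  exists lo hi : 'I_n, (lo <= hi)%N /\ I = [set i : 'I_n | (lo <= i <= hi)%N].

Definition interval_system (n : nat) (II : {set {set 'I_n}}) : Prop :=
  (forall I, I \in II -> subinterval I) /\
  (forall I J, I \in II -> J \in II -> I \subset J -> I = J).

Definition even_interval_system (n : nat) (II : {set {set 'I_n}}) : Prop :=
  interval_system II /\
  (forall I J, I \in II -> J \in II -> ~~ odd #|I :&: J|).

(** * The posets P(n, II, N) and the flag vector of DP(n, II) *)

(* The order in which the intervals are applied is irrelevant up to
   isomorphism; we take that of [enum II]. *)
Definition Pnin (n : nat) (II : {set {set 'I_n}}) (N : nat) : ranked :=
  foldr (fun I Q => D I N Q) (chain_poset n.+1) (enum II).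

(* The limit exists: D_I^N multiplies f_S by N if S meets I and by 1
   otherwise, so the ratio is eventually a power N^-m with m >= 0. *)
Definition flagDP (R : realType) (n : nat) (II : {set {set 'I_n}})
    (S : {set 'I_n}) : R :=
  2 ^+ #|S| *
  lim ((fun N => (flagf (Pnin II N) S)%:R / N%:R ^+ #|II| : R) @ \oo)%classic.

Lemma chain_graded r : graded (chain_poset r) r.
Proof.
split=> /=.
- by move=> i; rewrite /= ltnn.
- by move=> j i k; apply: ltn_trans.
- by exists ord0 => //= i; rewrite -(inj_eq val_inj) lt0n.
- exists ord_max => //= i ne; rewrite ltn_neqAle -ltnS ltn_ord andbT.
  by rewrite -(inj_eq val_inj) in ne.
- move=> i j [/= ij no]; apply/eqP; rewrite eqn_leq ij andbT leqNgt.
  apply/negP=> lt_ij; apply: no.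
  by exists (Ordinal (ltn_trans lt_ij (ltn_ord j))) => /=.
Qed.

Lemma mem_ranks n (S : {set 'I_n}) r :
  (r \in ranks S) = [exists i in S, r == (val i).+1].
Proof.
apply/imfsetP/existsP => [[i /= iS ->]|[i /andP[iS /eqP ->]]].
  by exists i; rewrite iS eqxx.
by exists i.
Qed.

Lemma ranks_interval n (I : {set 'I_n}) p q r : subinterval I ->
  p \in ranks I -> r \in ranks I -> (p <= q <= r)%N -> q \in ranks I.
Proof.
case=> lo [hi [_ ->]]; rewrite !mem_ranks => /existsP[i /andP[+ /eqP->]].
rewrite inE => /andP[lo_i i_hi] /existsP[k /andP[+ /eqP->]].
rewrite inE => /andP[lo_k k_hi]; case: q => //= q /andP[].
rewrite !ltnS => iq qk; apply/existsP.
exists (Ordinal (leq_ltn_trans qk (ltn_ord k))).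
by rewrite inE /= (leq_trans lo_i iq) (leq_trans qk k_hi) eqxx.
Qed.

Lemma D_graded n (I : {set 'I_n}) N (P : ranked) :
  subinterval I -> (0 < N)%N -> graded P n.+1 -> graded (D I N P) n.+1.
Proof.
move=> intI N_gt0 gP; have mono := graded_rho_lt gP.
case: gP => irr tr [bot botP rbot] [top topP rtop] cov.
have botI : ~~ @in_ranks _ I P bot.
  by rewrite /in_ranks rbot mem_ranks; apply/existsP => -[i /andP[]].
have topI : ~~ @in_ranks _ I P top.
  rewrite /in_ranks rtop mem_ranks; apply/existsP => -[i /andP[_]].
  by rewrite eqSS eq_sym (ltn_eqF (ltn_ord i)).
have ltDval (u v : elt (D I N P)) : rlt u v -> rlt (Dval u) (Dval v).
  by case: u v => [x|[x i]] [y|[y j]] //= /andP[].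
split=> /=.
- by move=> [x|[x i]] /=; rewrite irr ?andbF.
- move=> v u w uv vw; have := tr _ _ _ (ltDval _ _ uv) (ltDval _ _ vw).
  case: u v w uv vw => [x|[x i]] [y|[y j]] [z|[z k]] //= => [xy yz xz|].
    rewrite xz andbT; case/negP: (valP y).
    apply: (ranks_interval intI (valP x) (valP z)).
    by rewrite (ltnW (mono _ _ xy)) (ltnW (mono _ _ yz)).
  by move=> /andP[/eqP-> _] /andP[/eqP-> _]; rewrite eqxx.
- exists (inl (exist _ bot botI)) => // -[x|[x i]] /= ne; apply: botP.
    by apply: contraNneq ne => e; apply/eqP; congr inl; apply: val_inj.
  by apply: contraNneq botI => <-; exact: (valP x).
- exists (inl (exist _ top topI)) => // -[x|[x i]] /= ne; apply: topP.
    by apply: contraNneq ne => e; apply/eqP; congr inl; apply: val_inj.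
  by apply: contraNneq topI => <-; exact: (valP x).
move=> u v [uv no]; apply: cov; split; first exact: ltDval.
case=> z [uz zv]; apply: no.
case: (boolP (@in_ranks _ I P z)) => zI; last first.
  by exists (inl (exist _ z zI)); case: u v uv uz zv => [x|[x i]] [y|[y j]].
pose w i : Delt I N P := inr (exist _ z zI, i).
case: u v uv uz zv => [x|[x i]] [y|[y j]] /= uv uz zv.
- by exists (w (Ordinal N_gt0)).
- by exists (w j); rewrite /= eqxx.
- by exists (w i); rewrite /= eqxx.
- by exists (w i); case/andP: uv => /eqP-> _; rewrite /= eqxx.
Qed.

Lemma Pnin_graded n (II : {set {set 'I_n}}) N :
  interval_system II -> (0 < N)%N -> graded (Pnin II N) n.+1.
Proof.
case=> intII _ N_gt0; rewrite /Pnin.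
have: {subset enum II <= II} by move=> I; rewrite mem_enum.
elim: (enum II) => [|I s IH] sub /=; first exact: chain_graded.
apply: D_graded => //; first by apply: intII; apply: sub; rewrite mem_head.
by apply: IH => J Js; apply: sub; rewrite inE Js orbT.
Qed.

(** * Noncommutative polynomials, ab-index and cd-index *)

Inductive ab_letter := La | Lb.
Inductive cd_letter := Lc | Ld.

Definition bool_of_ab x := if x is La then true else false.
Definition ab_of_bool x := if x then La else Lb.
Lemma bool_of_abK : cancel bool_of_ab ab_of_bool. Proof. by case. Qed.
HB.instance Definition _ := Countable.copy ab_letter (can_type bool_of_abK).

Definition bool_of_cd x := if x is Lc then true else false.
Definition cd_of_bool x := if x then Lc else Ld.
Lemma bool_of_cdK : cancel bool_of_cd cd_of_bool. Proof. by case. Qed.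
HB.instance Definition _ := Countable.copy cd_letter (can_type bool_of_cdK).

(* Words, and the free associative algebras R<a,b> and R<c,d> as monoid
   algebras of the free monoids. *)
Notation cd_word := (fmonom cd_letter).
Notation ab_poly R := (malg (fmonom ab_letter) R).
Notation cd_poly R := (malg (fmonom cd_letter) R).

Definition weight (w : cd_word) : nat :=
  (count_mem Lc w + 2 * count_mem Ld w)%N.

Section Indices.
Variable R : realType.

Definition avar : ab_poly R := mkmalgU (fmu La) 1.
Definition bvar : ab_poly R := mkmalgU (fmu Lb) 1.
Definition cd_monomial (w : cd_word) : cd_poly R := mkmalgU w 1.

Section ABIndex.
Variables (n : nat) (f : {set 'I_n} -> R).

Definition hvec (S : {set 'I_n}) : R :=
  \sum_(T : {set 'I_n} | T \subset S) (-1) ^+ #|S :\: T| * f T.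

Definition uword (S : {set 'I_n}) : ab_poly R :=
  \prod_(i < n) (if i \in S then bvar else avar).

Definition ab_index : ab_poly R := \sum_(S : {set 'I_n}) hvec S *: uword S.

End ABIndex.

Definition cd_letter_subst (x : cd_letter) : ab_poly R :=
  match x with
  | Lc => avar + bvar
  | Ld => avar * bvar + bvar * avar
  end.

(* The value of Phi(c,d) at c = a+b, d = ab+ba. *)
Definition cd_subst (Phi : cd_poly R) : ab_poly R :=
  mmap (fun r : R => r%:A) (fun w : cd_word => \prod_(x <- w) cd_letter_subst x)
    Phi.

Definition is_cd_index (Psi : ab_poly R) (Phi : cd_poly R) : Prop :=
  Psi = cd_subst Phi.

End Indices.

(* Main.v *)
(* Take one interval {p, p+1} for each letter d of w, placed where that d sits;
   these intervals are pairwise disjoint.  Since D_I^N multiplies f_S by N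
   exactly when S meets I, the limit defining f_S(DP) is 2^|S| if S meets every
   interval and 0 otherwise.  As h is a Moebius transform, Psi is the sum over T
   of f_T times the word with b at the places of T and a - b elsewhere; this
   sum factors along w, a letter c contributing 2b + (a - b) = a + b and a
   letter d contributing 4bb + 2b(a - b) + 2(a - b)b = 2(ab + ba). *)
Require Import Defs.
From mathcomp Require Import all_boot all_order all_algebra reals.
From mathcomp Require Import -(notations) monalg.
From mathcomp Require Import finmap topology normedtype sequences zify.

Import Order.TTheory GRing.Theory Num.Theory.
Import numFieldNormedType.Exports.
Local Open Scope ring_scope.

(** * Flag numbers of a chain *)

Lemma flagf_chain_poset n (S : {set 'I_n}) : flagf (chain_poset n.+1) S = 1%N.
Proof.
pose up (i : 'I_n) : 'I_n.+2 := inord i.+1.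
have upE i : up i = i.+1 :> nat by rewrite inordK // !ltnS ltnW.
have up_homo : {homo up : i j / relpre val ltn i j >-> (i < j)%N}.
  by move=> i j /= ij; rewrite !upE ltnS.
(* A chain poset has one element of each rank, so the rank set [S] determines the chain: [t0] lists
   its elements in increasing order. *)
pose t0 : #|S|.-tuple 'I_n.+2 := map_tuple up (enum_tuple S).
apply/eqP/cards1P; exists t0; apply/setP => t; rewrite !inE /=.
have t0_sorted : sorted (fun i j : 'I_n.+2 => (i < j)%N) t0.
  rewrite /= /enum_mem -enumT /=.
  apply: (homo_sorted (e := relpre val ltn)) up_homo _ _.
  apply: sorted_filter; first by move=> ? ? ?; exact: ltn_trans.
  by rewrite -sorted_map val_enum_ord iota_ltn_sorted.
have t0_mem (i : 'I_n.+2) : (i \in t0) = (val i \in ranks S).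
  rewrite mem_ranks; apply/mapP/existsP => [[j jS ->]|[j /andP[jS /eqP e]]].
    by exists j; rewrite -[j \in S]mem_enum jS /= upE eqxx.
  by exists j; rewrite ?mem_enum //; apply: val_inj; rewrite /= upE.
have lt_irr : irreflexive (fun i j : 'I_n.+2 => (i < j)%N) by move=> i; exact: ltnn.
have lt_tr : transitive (fun i j : 'I_n.+2 => (i < j)%N).
  by move=> j i k; exact: ltn_trans.
apply/andP/eqP => [[t_sorted /eqP t_ranks]|->].
  apply/val_inj/(irr_sorted_eq lt_tr lt_irr) => //= i.
  rewrite [RHS]t0_mem -t_ranks; apply/idP/imfsetP => [it|[j jt /val_inj->]] //.
  by exists i.
split=> //; apply/eqP/fsetP => r; apply/imfsetP/idP => [[i /= + ->]|rS].
  by rewrite t0_mem.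
move: (rS); rewrite mem_ranks => /existsP[j /andP[jS /eqP e]].
by exists (up j); rewrite /= ?upE // t0_mem /= upE -e.
Qed.

(** * Effect of replication on flag numbers *)

Section FlagReplicate.
Variables (n : nat) (I : {set 'I_n}) (N : nat) (P : ranked).

(** The section of [Dval] with index [i]: it embeds [P] as the [i]-th layer of the replicated poset.
    The layers share the elements with ranks outside [I]. *)
Definition copy (i : 'I_N) (x : elt P) : elt (D I N P) :=
  match boolP (in_ranks I x) with
  | AltTrue xI => inr (exist _ x xI, i)
  | AltFalse xI => inl (exist _ x xI)
  end.

Lemma Dval_copy i : cancel (copy i) (@Dval n I N P).
Proof. by move=> x; rewrite /copy; case: {-}_ / boolP. Qed.

Lemma rlt_copy i x y : rlt (copy i x) (copy i y) = rlt x y.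
Proof.
by rewrite /copy; case: {-}_ / boolP => ?; case: {-}_ / boolP => ? //=; rewrite eqxx.
Qed.

Lemma copy_Dval_inl i x : copy i (Dval (inl x : elt (D I N P))) = inl x.
Proof.
rewrite /copy /=; case: {-}_ / boolP => xI; last by congr inl; apply: val_inj.
by case/negP: (valP x).
Qed.

Lemma copy_Dval_inr i x : copy i (Dval (inr (x, i) : elt (D I N P))) = inr (x, i).
Proof.
rewrite /copy /=; case: {-}_ / boolP => xI; first by congr (inr (_, _)); apply: val_inj.
by case/negP: xI; exact: (valP x).
Qed.

Lemma copy_inj_index i j x : in_ranks I x -> copy i x = copy j x -> i = j.
Proof. by move=> xI; rewrite /copy; case: {-}_ / boolP => [? []|/negP []]. Qed.

(* Copies with different indices are never comparable. *)
Lemma chain_copy r (t : seq (elt (D I N P))) :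
    (0 < N)%N -> graded (D I N P) r -> sorted (@rlt (D I N P)) t ->
  exists i, t = [seq copy i (Dval u) | u <- t].
Proof.
move=> N_gt0 [_ tr _ _ _] t_sorted.
suff [i it] : exists i, {in t, forall u, copy i (Dval u) = u}.
  by exists i; rewrite -[LHS]map_id; apply/eq_in_map => u /it.
(* Any replicated element of [t] supplies the index; a chain without one lies in every layer. *)
case: (pickP (fun u : elt (D I N P) => (u \in t) && if u is inr _ then true else false)).
  move=> [x|[x i]] /=; rewrite ?andbF // andbT => xt; exists i => -[y|[y j]] yt.
    exact: copy_Dval_inl.
  suff -> : i = j by exact: copy_Dval_inr.
  move: t_sorted; rewrite (sorted_pairwise tr) => /(pairwiseP (inr (x, i))) pw.
  have := pw (index (inr (x, i)) t) (index (inr (y, j)) t).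
  have := pw (index (inr (y, j)) t) (index (inr (x, i)) t).
  rewrite !inE !index_mem xt yt !nth_index //= => /(_ isT isT) ji /(_ isT isT) ij.
  case: (ltngtP (index (inr (x, i)) t) (index (inr (y, j)) t)) => [/ij|/ji|e].
  - by case/andP=> /eqP.
  - by case/andP=> /eqP->.
  - have := nth_index (inr (x, i)) xt.
    by rewrite e nth_index // => -[].
move=> none; exists (Ordinal N_gt0) => -[y|[y j]] yt; first exact: copy_Dval_inl.
by move: (none (inr (y, j))); rewrite yt.
Qed.

(** A chain of [P] that meets [I] has [N] distinct lifts, one in each layer; a chain that avoids [I]
    has the same lift in all layers. *)
Lemma flagf_D (S : {set 'I_n}) :
    subinterval I -> (0 < N)%N -> graded P n.+1 ->
  flagf (D I N P) S =
    (flagf P S * (if [exists i in S, i \in I] then N else 1))%N.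
Proof.
move=> intI N_gt0 gP; have gD := D_graded intI N_gt0 gP.
pose i0 := Ordinal N_gt0; set J := [exists i in S, i \in I].
pose chains (Q : ranked) := [set t : #|S|.-tuple (elt Q) |
  sorted (@rlt Q) t && ([fset rho x | x in tval t]%fset == ranks S)].
pose lift (p : #|S|.-tuple (elt P) * 'I_N) : #|S|.-tuple (elt (D I N P)) :=
  map_tuple (copy p.2) p.1.
(* If [S] misses [I], the index is frozen at [i0] so that [lift] stays injective on [A]. *)
pose A := setX (chains P) (if J then setT else [set i0]).
have lift_chains t i : (lift (t, i) \in chains (D I N P)) = (t \in chains P).
  rewrite !inE /=; congr andb; last congr (_ == _).
    by rewrite sorted_map; apply: eq_sorted => x y; exact: rlt_copy.
  apply/fsetP => r; apply/imfsetP/imfsetP => [[u /= /mapP[x xt ->]]|[x /= xt]] ->.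
    by exists x; rewrite //= Dval_copy.
  by exists (copy i x); rewrite /= ?map_f ?Dval_copy.
have meets t : t \in chains P -> J = has (@in_ranks n I P) t.
  rewrite inE => /andP[_ /eqP t_ranks].
  apply/existsP/hasP => [[j /andP[jS jI]]|[x xt]].
    have : j.+1 \in ranks S by rewrite mem_ranks; apply/existsP; exists j; rewrite jS /=.
    rewrite -t_ranks => /imfsetP[x /= xt e]; exists x => //.
    by rewrite /in_ranks -e mem_ranks; apply/existsP; exists j; rewrite jI /=.
  have : rho x \in ranks S by rewrite -t_ranks; apply/imfsetP; exists x.
  rewrite /in_ranks !mem_ranks => /existsP[j /andP[jS /eqP ->]].
  case/existsP=> k /andP[kI /eqP[e]]; exists j; rewrite jS /=.
  by rewrite (_ : j = k) //; apply: val_inj.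
have -> : flagf (D I N P) S = #|lift @: A|.
  rewrite /flagf -/(chains _); apply: eq_card => t.
  apply/idP/imsetP => [t_chain|[[s i] /setXP[sP _] ->]]; last by rewrite lift_chains.
  have := t_chain; rewrite inE => /andP[t_sorted _].
  have [i t_copy] := chain_copy _ _ N_gt0 gD t_sorted.
  (* Projecting [t] to [P] and lifting back with its common index recovers [t]. *)
  pose s := map_tuple (@Dval n I N P) t.
  have tE : t = lift (s, i).
    by apply: val_inj; rewrite /= -map_comp [LHS]t_copy.
  have sP : s \in chains P by rewrite -(lift_chains _ i) -tE.
  case: (boolP J) => [JT|JF]; first by exists (s, i); rewrite // inE sP JT inE.
  exists (s, i0); first by rewrite inE sP (negbTE JF) !inE eqxx.
  rewrite tE; apply: val_inj => /=; apply/eq_in_map => x xs.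
  have /hasPn /(_ x xs) xI : ~~ has (@in_ranks n I P) s by rewrite -(meets _ sP).
  by rewrite /copy; case: {-}_ / boolP => // x_in; case/negP: xI.
(* [Dval] recovers the chain from its lift; an element with rank in [I] recovers the index, which is
   [i0] when there is no such element. *)
rewrite card_in_imset; last first.
  move=> [s i] [s' i'] /setXP[/= sP iA] /setXP[/= _ iA'] e.
  have es : s = s'.
    apply: val_inj; rewrite -[LHS](mapK (Dval_copy i)) -[RHS](mapK (Dval_copy i')).
    by move: e => /(congr1 val) /= ->.
  rewrite -{}es in e *; congr (_, _).
  move: iA iA'; rewrite (meets _ sP); case: hasP => [[x xs xI] _ _|_].
    by apply: (copy_inj_index _ _ _ xI); move/(congr1 val)/eq_in_map: e => /(_ x xs).
  by move=> /set1P-> /set1P->.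
by rewrite /A cardsX; congr (_ * _)%N; case: ifP => _; rewrite ?cardsT ?card_ord ?cards1.
Qed.

End FlagReplicate.

(** * The flag vector of the doubled limit poset *)

Lemma flagf_Pnin n (II : {set {set 'I_n}}) N (S : {set 'I_n}) :
    interval_system II -> (0 < N)%N ->
  flagf (Pnin II N) S = (N ^ #|[set I in II | [exists i in S, i \in I]]|)%N.
Proof.
case=> intII _ N_gt0.
pose meets (I : {set 'I_n}) := [exists i in S, i \in I].
have -> : #|[set I in II | meets I]| = count meets (enum II).
  rewrite -size_filter cardE /enum_mem -filter_predI; congr size.
  by apply: eq_filter => I; rewrite /= !inE andbC.
rewrite /Pnin.
have: {subset enum II <= II} by move=> I; rewrite mem_enum.
(* Gradedness is carried through the induction because [flagf_D] asks for it at each replication. *)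
suff H s : {subset s <= II} ->
    let Q := foldr (fun I Q => D I N Q) (chain_poset n.+1) s in
    graded Q n.+1 /\ flagf Q S = (N ^ count meets s)%N by case/H.
elim: s => [|I s IH] sub /=.
  by split; [exact: chain_graded | rewrite flagf_chain_poset].
have intI : subinterval I by apply: intII; apply: sub; rewrite mem_head.
have [|gQ fQ] := IH; first by move=> J Js; apply: sub; rewrite inE Js orbT.
split; first exact: D_graded.
rewrite flagf_D // fQ expnD mulnC; congr (_ * _)%N.
by rewrite /meets; case: ifP; rewrite ?expn1.
Qed.

Lemma flagDPE (R : realType) n (II : {set {set 'I_n}}) (S : {set 'I_n}) :
    interval_system II ->
  flagDP R II S =
    (2 ^ #|S| * [forall I in II, [exists i in S, i \in I]])%:R.
Proof.
move=> sysII; rewrite /flagDP natrM natrX; congr (_ * _).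
set J := [set I in II | [exists i in S, i \in I]].
have subJ : J \subset II by apply/fintype.subsetP => I; rewrite inE => /andP[].
have -> : [forall I in II, [exists i in S, i \in I]] = (II \subset J).
  apply/forall_inP/fintype.subsetP => H I II_I; last first.
    by have := H I II_I; rewrite inE => /andP[].
  by rewrite inE II_I H.
(* The shift to [N.+1] keeps the replication number positive, as [flagf_Pnin] and the cancellation
   of powers require. *)
apply/cvg_lim => //; rewrite -cvg_shiftS /=.
have flagE N : (flagf (Pnin II N.+1) S)%:R / N.+1%:R ^+ #|II| =
    N.+1%:R^-1 ^+ (#|II| - #|J|) :> R.
  rewrite flagf_Pnin // natrX -/J -{1}(subnK (subset_leq_card subJ)).
  by rewrite exprD invfM mulrCA mulfV ?mulr1 ?exprVn // expf_neq0 ?pnatr_eq0.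
rewrite (eq_cvg _ _ flagE).
case: (boolP (II \subset J)) => [IIJ|IIJ].
  rewrite (eqP (_ : #|II| - #|J| == 0)%N) ?subn_eq0 ?subset_leq_card //.
  exact: cvg_cst.
have : (0 < #|II| - #|J|)%N.
  by rewrite subn_gt0 proper_card // properE subJ.
case: (_ - _)%N => // m _; elim: m => [|m IH]; first exact: cvg_harmonic.
have := cvgM (@cvg_harmonic R) IH; rewrite mulr0 => H.
rewrite (eq_cvg _ _ (fun N => exprS _ _)); exact: (H _).
Qed.

(** * The ab-index as a sum of products *)

(** The left side is the term of [S] when a product with factors [b + 0] on [T] and [- b + a] off
    [T] is expanded. A place of [T] outside [S] kills the term; each place of [S :\: T] gives a
    sign, which commutes with all letters. *)
Lemma prod_signed_letters (A : nzRingType) n (S T : {set 'I_n}) (r : seq 'I_n) (a b : A) :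
  \prod_(i <- r) (if i \in S then if i \in T then b else - b
                  else if i \in T then 0 else a) =
  (if all (fun i => (i \in T) ==> (i \in S)) r
   then (-1) ^+ count (mem (S :\: T)) r * \prod_(i <- r) (if i \in S then b else a)
   else 0).
Proof.
elim: r => [|i r IH]; first by rewrite !big_nil mul1r.
rewrite !big_cons IH /= inE; case: (i \in S); case: (i \in T); rewrite /= ?mul0r //.
all: case: ifP => _; rewrite ?mulr0 ?add0n ?add1n ?exprS //.
- by rewrite mulrA commr_sign mulrA.
- by rewrite mulN1r !mulNr mulrA commr_sign mulrA.
- by rewrite mulrA commr_sign mulrA.
Qed.

Lemma ab_indexE (R : realType) n (f : {set 'I_n} -> R) :
  ab_index f = \sum_T f T *: \prod_(i < n) (if i \in T then bvar R else avar R - bvar R).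
Proof.
transitivity (\sum_(S : {set 'I_n}) \sum_(T : {set 'I_n} | T \subset S)
    ((-1) ^+ #|S :\: T| * f T) *: uword R S).
  by apply: eq_bigr => S _; exact: scaler_suml.
rewrite (exchange_big_dep predT) //=; apply: eq_bigr => T _.
under eq_bigr => S _ do rewrite mulrC -scalerA.
rewrite -scaler_sumr; congr (_ *: _).
(* With the summand 0 on [T], the distributive law may range over all subsets [S]: those not
   containing [T] contribute nothing. *)
transitivity (\prod_(i < n) ((if i \in T then bvar R else - bvar R) +
                             (if i \in T then 0 else avar R))).
  rewrite bigA_distr big_mkcond /=; apply: eq_bigr => S _.
  rewrite prod_signed_letters.
  have -> : all (fun i => (i \in T) ==> (i \in S)) (index_enum 'I_n) = (T \subset S).
    apply/allP/fintype.subsetP => H i; last by move=> _; apply/implyP/H.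
    by move/(implyP (H i (mem_index_enum i))).
  case: ifP => // _; rewrite -signr_odd scaler_sign -mulr_sign signr_odd.
  rewrite /uword; congr ((-1) ^+ _ * _).
  by rewrite -sum1_count sum1_card.
by apply: eq_bigr => i _; case: ifP; rewrite ?addr0 // addrC.
Qed.

(** * Sums over boolean words and their factorization along a cd-word *)

Lemma big_bool_tupleS (V : nmodType) n (g : seq bool -> V) :
  \sum_(t : n.+1.-tuple bool) g t =
  \sum_(t : n.-tuple bool) (g (true :: t) + g (false :: t)).
Proof.
rewrite (reindex (fun p : bool * n.-tuple bool => cons_tuple p.1 p.2)) /=; last first.
  exists (fun t => (thead t, behead_tuple t)) => [[x t] _|t _].
    by congr (_, _); apply: val_inj.
  by apply: val_inj; rewrite /= [in RHS](tuple_eta t).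
rewrite big_split -(pair_bigA _ (fun x (t : n.-tuple bool) => g (x :: t))) /=.
by rewrite big_bool.
Qed.

(** Characteristic words replace subsets so that the sum can be peeled place by place along [w]. *)
Lemma big_set_tuple (V : nmodType) n (F : {set 'I_n} -> V) :
  \sum_T F T = \sum_(t : n.-tuple bool) F [set i | tnth t i].
Proof.
rewrite (reindex (fun t : n.-tuple bool => [set i | tnth t i])) //=.
exists (fun T : {set 'I_n} => [tuple i \in T | i < n]) => [t _|T _].
  by apply: eq_from_tnth => i; rewrite tnth_mktuple inE.
by apply/setP => i; rewrite inE tnth_mktuple.
Qed.

(* A letter d occupies two places of [1,n]; p is the rank of the first one, minus 1. *)
Fixpoint d_positions (w : seq cd_letter) : seq nat :=
  match w with
  | [::] => [::]
  | Lc :: w' => [seq p.+1 | p <- d_positions w']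
  | Ld :: w' => 0 :: [seq p.+2 | p <- d_positions w']
  end.

(** Recursion on the word makes tuples of this length gain one or two places by computation as a
    letter is added. *)
Fixpoint word_weight (w : seq cd_letter) : nat :=
  match w with
  | [::] => 0
  | Lc :: w' => (word_weight w').+1
  | Ld :: w' => (word_weight w').+2
  end.

Lemma word_weightE (w : cd_word) : weight w = word_weight w.
Proof.
rewrite /weight; elim: (w : seq _) => //= -[] s <- /=; first by rewrite add0n.
by rewrite add0n add1n mulnSr addnCA addn2 addnC.
Qed.

Lemma d_positions_lt w p : p \in d_positions w -> (p.+1 < word_weight w)%N.
Proof.
elim: w p => //= -[] w IH p; first by case/mapP => q /IH ? ->.
by rewrite inE => /orP[/eqP->|/mapP[q /IH ? ->]].
Qed.

(** Each [d] takes up two places; this makes the intervals of different letters [d] disjoint. *)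
Lemma d_positions_gap w p q :
  p \in d_positions w -> q \in d_positions w -> (p < q)%N -> (p.+1 < q)%N.
Proof.
elim: w p q => //= -[] w IH p q.
  by case/mapP => p' p'w -> /mapP[q' q'w ->]; rewrite !ltnS; exact: IH.
rewrite !inE => /orP[/eqP->|/mapP[p' p'w ->]] /orP[/eqP->|/mapP[q' q'w ->]] //.
by rewrite !ltnS; exact: IH.
Qed.

(** The flag number of the doubled limit poset at the set whose characteristic word is [s]. *)
Definition word_flag (w : seq cd_letter) (s : seq bool) : nat :=
  2 ^ count id s * all (fun p => nth false s p || nth false s p.+1) (d_positions w).

Lemma sum_word_flag (A : nzRingType) (a b : A) (w : seq cd_letter) :
  \sum_(t : (word_weight w).-tuple bool)
    (\prod_(x <- t) (if x then b else a - b)) *+ word_flag w t =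
  (\prod_(x <- w) (if x is Lc then a + b else a * b + b * a)) *+ 2 ^ count_mem Ld w.
Proof.
pose X (x : bool) := if x then b else a - b.
elim: w => [|x w IH].
  rewrite (big_pred1 [tuple]) ?big_nil // => t.
  by apply/esym/eqP; exact: (tuple0 t).
case: x; rewrite big_cons /=.
  rewrite (big_bool_tupleS _ _ (fun s => (\prod_(x <- s) X x) *+ word_flag (Lc :: w) s)).
  rewrite add0n -mulrnAr -IH mulr_sumr; apply: eq_bigr => t _.
  rewrite !big_cons /word_flag /= !all_map /preim /= add1n add0n expnS.
  rewrite -mulnA mulrnA -mulrnDl -mulrnAl -mulrDl -mulrnAr; congr (_ * _).
  (* The letter c: [2b + (a - b) = a + b]. *)
  by rewrite mulr2n addrACA subrr addr0 addrC.
pose g s := (\prod_(x <- s) X x) *+ word_flag (Ld :: w) s.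
rewrite (big_bool_tupleS _ _ g).
rewrite (big_bool_tupleS _ _ (fun s => g (true :: s) + g (false :: s))).
rewrite add1n expnSr mulrnA -mulrnAr -IH mulr_sumr -sumrMnl.
apply: eq_bigr => t _; set m := word_flag w t.
(* The two places of [d] split off with weight 4 for [bb], 2 when exactly one of them is chosen, and
   0 when neither is. *)
have gE x y : g [:: x, y & t] =
    (X x * X y * (\prod_(x <- t) X x *+ m)) *+ (2 ^ (x + y) * (x || y)).
  rewrite /g /m /word_flag !big_cons /= all_map /preim /= mulrA addnA.
  rewrite mulrnAr -mulrnA; congr (_ *+ _).
  by rewrite expnD; case: (x || y); rewrite /= ?muln0 // muln1 -mulnA mulnC.
set Q := \prod_(x <- t) X x *+ m.
have factor x y z : x * Q *+ 4 + y * Q *+ 2 + z * Q *+ 2 = (x + x + y + z) * Q *+ 2.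
  by rewrite !mulrDl !mulrnDl -mulrnDr.
transitivity (b * b * Q *+ 4 + (a - b) * b * Q *+ 2 + b * (a - b) * Q *+ 2).
  by rewrite !gE -/Q /= addr0 addrAC.
(* With one factor 2 taken out, [bb + bb + (a - b)b + b(a - b) = ab + ba] remains. *)
rewrite factor; congr (_ * _ *+ 2).
rewrite mulrBl mulrBr [X in X + _]addrACA subrr addr0 [b * b + _]addrC.
by rewrite addrACA subrr addr0.
Qed.

(** * The interval system of a cd-word *)

Section DSystem.
Variables (R : realType) (w : seq cd_letter).
Local Notation n := (word_weight w).

Definition pair_interval (p : 'I_n) : {set 'I_n} := [set i : 'I_n | (p <= i <= p.+1)%N].

Definition d_system : {set {set 'I_n}} :=
  [set pair_interval p | p : 'I_n & val p \in d_positions w].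

Lemma pair_intervalE (p : 'I_n) (lt_p : (p.+1 < n)%N) :
  pair_interval p = [set p; Ordinal lt_p].
Proof.
by apply/setP => i; rewrite !inE -!val_eqE /=; lia.
Qed.

(** Distinct intervals are disjoint and each has two elements, so all intersections have size 0 or
    2. Being nonempty and disjoint, distinct intervals cannot be nested. *)
Lemma d_system_even : even_interval_system d_system.
Proof.
have disj (p q : 'I_n) : val p \in d_positions w -> val q \in d_positions w ->
    (p < q)%N -> pair_interval p :&: pair_interval q = set0.
  move=> pw qw lt_pq; have := d_positions_gap _ _ _ pw qw lt_pq.
  move=> gap; apply/setP => i; rewrite !inE; apply/negP.
  case/andP=> /andP[_ i_p] /andP[q_i _].
  by have := leq_trans q_i i_p; rewrite leqNgt gap.
have lt_n (p : 'I_n) : val p \in d_positions w -> (p.+1 < n)%N := d_positions_lt w p.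
have p_in (p : 'I_n) : p \in pair_interval p by rewrite inE leqnn leqnSn.
split; first split.
- move=> _ /imsetP[p + ->]; rewrite inE => /lt_n lt_p.
  by exists p, (Ordinal lt_p); rewrite leqnSn.
- move=> _ _ /imsetP[p + ->] /imsetP[q + ->]; rewrite !inE => pw qw /fintype.subsetP sub.
  have := sub p (p_in p); have := p_in p; case: (ltngtP p q) => [lt|lt|/val_inj->] //.
    by move=> ip iq; have := disj p q pw qw lt => /setP/(_ p); rewrite inE ip iq inE.
  by move=> ip iq; have := disj q p qw pw lt => /setP/(_ p); rewrite inE ip iq inE.
move=> _ _ /imsetP[p + ->] /imsetP[q + ->]; rewrite !inE => pw qw.
case: (ltngtP p q) => [lt|lt|/val_inj<-].
- by rewrite disj // cards0.
- by rewrite setIC disj // cards0.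
by rewrite setIid (pair_intervalE p (lt_n p pw)) cards2 -val_eqE /= (ltn_eqF (ltnSn p)).
Qed.

Lemma d_system_meets (t : n.-tuple bool) (S := [set i | tnth t i]) :
  [forall I in d_system, [exists i in S, i \in I]] =
  all (fun p => nth false t p || nth false t p.+1) (d_positions w).
Proof.
have meetE (p : 'I_n) (lt_p : (p.+1 < n)%N) :
    [exists i in S, i \in pair_interval p] = nth false t p || nth false t p.+1.
  rewrite (pair_intervalE p lt_p) -!(tnth_nth false t p) -(tnth_nth false t (Ordinal lt_p)).
  apply/existsP/orP => [[i]|].
    by rewrite !inE => /andP[ti /orP[/eqP e|/eqP e]]; [left|right]; rewrite -e.
  by case=> ti; [exists p|exists (Ordinal lt_p)]; rewrite !inE ti eqxx ?orbT.
apply/forall_inP/allP => [H p pw|H _ /imsetP[p + ->]].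
  have lt_p := d_positions_lt w p pw.
  rewrite -(meetE (Ordinal (ltnW lt_p)) lt_p); apply: H.
  by apply: imset_f; rewrite inE.
by rewrite inE => pw; rewrite meetE ?H //; exact: d_positions_lt.
Qed.

Lemma d_system_flag (t : n.-tuple bool) :
  flagDP R d_system [set i | tnth t i] = (word_flag w t)%:R.
Proof.
rewrite flagDPE ?d_system_meets; last by case: d_system_even.
rewrite /word_flag; congr ((_ ^ _ * _)%N%:R).
rewrite -sum1_card -sum1_count big_tuple.
by apply: eq_bigl => i; rewrite inE.
Qed.

Lemma ab_index_d_system :
  ab_index (flagDP R d_system) =
  (\prod_(x <- w) cd_letter_subst R x) *+ 2 ^ count_mem Ld w.
Proof.
rewrite ab_indexE big_set_tuple; transitivity
  (\sum_(t : n.-tuple bool)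
     (\prod_(x <- t) (if x then bvar R else avar R - bvar R)) *+ word_flag w t).
  apply: eq_bigr => t _; rewrite d_system_flag scaler_nat big_tuple; congr (_ *+ _).
  by apply: eq_bigr => i _; rewrite inE.
exact: sum_word_flag.
Qed.

End DSystem.

Theorem proposition2p9 (R : realType) (n k : nat) (w : cd_word)
    (hk : count_mem Ld w = k) (hn : weight w = n) :
  exists II : {set {set 'I_n}},
    even_interval_system II /\
    is_cd_index (ab_index (flagDP R II)) (2 ^+ k *: cd_monomial R w).
Proof.
move: hn; rewrite word_weightE => <-; rewrite -hk.
exists (d_system w); split; first exact: d_system_even.
rewrite /is_cd_index ab_index_d_system.
have -> : 2 ^+ count_mem Ld w *: cd_monomial R w = mkmalgU w (2 ^+ count_mem Ld w).
  by apply/malgP => u; rewrite mcoeffZ !mcoeffU; case: eqP; rewrite ?mulr1 ?mulr0.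
(* Seen as the ring morphism [GRing.in_alg], the map from [r] to [r%:A] lets [mmapU] evaluate a
   single monomial. *)
have substU c : cd_subst (mkmalgU w c) = c%:A * \prod_(x <- w) cd_letter_subst R x.
  exact: (mmapU (f := GRing.in_alg (ab_poly R))).
by rewrite substU -natrX scaler_nat mulr_natl.
Qed.
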